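(* Let $f,g:[0,1]\to[0,1]$ be given by $f(x)=3x$ for $x\in[0,\frac13]$, $f(x)=-3x+2$ for $x\in(\frac13,\frac23)$, $f(x)=3x-2$ for $x\in[\frac23,1]$, and $g(x)=\frac13x$. Consider the random dynamical system applying $f$ with probability $p$ and $g$ with probability $1-p$ at each step. If $\frac12<p\le 1$, then for every $x,y\in[0,1]$, $$\int_0^1\bigl(F_{xy}^\star(t)-F_{xy}(t)\bigr)\,\mathrm{d}t\le\frac{6p-3}{4p-1}.$$
   Context: At each step, independently, $f$ is applied with probability $p$ and $g$ with probability $1-p$. Formally, $\Omega=\{f,g\}^{\infty}$ carries the product probability measure $P$ under which the coordinates $\omega_1,\omega_2,\ldots$ are independent with $P(\omega_i=f)=p$, $P(\omega_i=g)=1-p$. For $x\in[0,1]$ the trajectory is $x_0=x$, $x_n(\omega)=\omega_n\circ\omega_{n-1}\circ\cdots\circ\omega_1(x)$. For two starting points $x,y$ the trajectories $x_n$ and $y_n$ are driven by the same $\omega$. Define, for $n\ge 1$ and $t\in\mathbb{R}$, $$F_{xy}^{(n)}(t)=\frac1n\sum_{i=0}^{n-1}P(|x_i-y_i|<t),\quad F_{xy}(t)=\liminf_{n\to\infty}F_{xy}^{(n)}(t),\quad F_{xy}^\star(t)=\limsup_{n\to\infty}F_{xy}^{(n)}(t).$$ *)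

(* Defs.v *)
From HB Require Import structures.
From mathcomp Require Import all_boot all_order all_algebra.
From mathcomp Require Import all_classical all_reals all_analysis.

Set Implicit Arguments.
Unset Strict Implicit.
Unset Printing Implicit Defensive.

Import Order.TTheory GRing.Theory Num.Theory.
Import numFieldNormedType.Exports.

Local Open Scope classical_set_scope.
Local Open Scope ring_scope.

(* The maps are self-maps of [0, 1]; they are written as total functions on R
   and only ever iterated from points of [0, 1]. *)
Definition fmap3 {R : realType} (x : R) : R :=
  if x <= 1 / 3 then 3 * x
  else if x < 2 / 3 then - 3 * x + 2
  else 3 * x - 2.

Definition gmap3 {R : realType} (x : R) : R := 1 / 3 * x.

(* A point w of {f,g}^oo is a sequence of booleans, [true] standing for f and
   [false] for g; [w n] is the coordinate omega_(n+1).  The sigma-algebra is the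
   product one, generated by the events {w n = b}. *)
Definition coord_events : set (set (nat -> bool)) :=
  [set A | exists n b, A = [set w | w n = b]].

Definition words := g_sigma_algebraType coord_events.

(* These conditions determine P uniquely: the one-coordinate marginals, and the
   product rule for every finite family of distinct coordinates. *)
Definition is_product_measure {R : realType} (p : R) (P : probability words R) :
    Prop :=
  [/\ forall n, P [set w : words | w n = true] = p%:E,
      forall n, P [set w : words | w n = false] = (1 - p)%:E
    & forall (J : seq nat) (A : nat -> set bool), uniq J ->
        P [set w : words | forall n, n \in J -> A n (w n)] =
        (\prod_(n <- J) P [set w : words | A n (w n)])%E].

Fixpoint trajectory {R : realType} (x : R) (n : nat) (w : words) : R :=
  match n with
  | 0 => x
  | m.+1 => (if w m then fmap3 else gmap3) (trajectory x m w)
  end.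

Definition Fn {R : realType} (P : probability words R) (x y : R) (n : nat)
    (t : R) : R :=
  n%:R^-1 * \sum_(0 <= i < n)
    fine (P [set w | `|trajectory x i w - trajectory y i w| < t]).

Definition Finf {R : realType} (P : probability words R) (x y t : R) : R :=
  limn_inf (fun n => Fn P x y n t).

Definition Fsup {R : realType} (P : probability words R) (x y t : R) : R :=
  limn_sup (fun n => Fn P x y n t).

(* Main.v *)
(** Since f o g = id, the word omega_n ... omega_1 reduces to g^k f^m, where the
   height k performs a random walk reflected at 0: up with probability 1 - p,
   down with probability p.  Hence |x_n - y_n| <= 3^-k.  For p > 1/2 the walk is
   positive recurrent with geometric stationary law of ratio r = (1 - p) / p, so
   F_xy(t) is at least the stationary probability of {3^-k < t}, while F*_xy <= 1.
   The integral of the difference is therefore at most the stationary mean of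
   3^-k, which is (1 - r) / (1 - r / 3) = (6 p - 3) / (4 p - 1). *)
Require Import Defs.
From HB Require Import structures.
From mathcomp Require Import all_boot all_order all_algebra.
From mathcomp Require Import all_classical all_reals all_analysis.
From mathcomp Require Import measurable_realfun ring lra.

Set Implicit Arguments.
Unset Strict Implicit.
Unset Printing Implicit Defensive.

Import Order.TTheory GRing.Theory Num.Theory.
Import numFieldNormedType.Exports.

Local Open Scope classical_set_scope.
Local Open Scope ring_scope.

(** * The height walk and its control of the trajectories *)

Fixpoint height (n : nat) (w : words) : nat :=
  if n is m.+1 then (if w m then (height m w).-1 else (height m w).+1) else 0%N.

(** The intended value of P([height n] >= j), computed by conditioning on the last letter applied;
    [prob_height_ge] confirms it. *)
Fixpoint tail_height {R : realType} (p : R) (n j : nat) : R :=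
  match n, j with
  | _, 0%N => 1
  | 0%N, _.+1 => 0
  | m.+1, i.+1 => p * tail_height p m i.+2 + (1 - p) * tail_height p m i
  end.

(** At positive height the point lies in [0, 1/3], where [fmap3] is multiplication by 3 and cancels
    one contraction; at height 0 only the invariance of [0, 1] is needed. *)
Lemma trajectory_ge0_le {R : realType} (x : R) (n : nat) (w : words) :
  0 <= x <= 1 -> 0 <= trajectory x n w <= 3^-1 ^+ height n w.
Proof.
move=> hx; elim: n => [|n IH] /=; first by rewrite expr0.
case: (w n).
  case: (height n w) IH => [|k]; rewrite /fmap3 /=.
    rewrite expr0 => IH.
    by case: ifP => h1; [lra|case: ifP => h2; lra].
  have k1 : (3^-1 : R) ^+ k <= 1.
    by rewrite exprn_ile1 // ?invr_ge0 // invf_le1 //; lra.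
  rewrite exprS => IH.
  by rewrite ifT; lra.
by rewrite /gmap3 exprS; lra.
Qed.

Lemma trajectory_dist_le {R : realType} (x y : R) (n : nat) (w : words) :
  0 <= x <= 1 -> 0 <= y <= 1 ->
  `|trajectory x n w - trajectory y n w| <= 3^-1 ^+ height n w.
Proof.
move=> /(trajectory_ge0_le n w) hx /(trajectory_ge0_le n w) hy.
by rewrite ler_norml; lra.
Qed.

(** * Measurability of events depending on finitely many letters *)

Lemma measurable_coord (n : nat) (b : bool) :
  measurable [set w : words | w n = b].
Proof. by apply: sub_sigma_algebra; exists n, b. Qed.

Lemma set_coord_split (n : nat) (E : bool -> set words) :
  [set w | E (w n) w] =
  ([set w : words | w n = true] `&` E true) `|`
  ([set w : words | w n = false] `&` E false).
Proof.
apply/seteqP; split=> [w|w [] [] /= ->] //=.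
by case E1: (w n) => h; [left|right].
Qed.

(** The state at time [n] is a function of the first [n] letters only, so [T] carries no
    sigma-algebra and [S] is arbitrary. The same lemma serves the height and the pair of
    trajectories. *)
Lemma measurable_prefix (T : Type) (s0 : T) (step : bool -> T -> T)
    (s : nat -> words -> T) (n : nat) (S : set T) :
  (forall w, s 0%N w = s0) -> (forall n w, s n.+1 w = step (w n) (s n w)) ->
  measurable [set w | S (s n w)].
Proof.
move=> s_0 s_S; elim: n S => [|n IH] S.
  have [h|h] := pselect (S s0).
    rewrite (_ : [set _ | _] = setT); first exact: measurableT.
    by apply/seteqP; split=> w //= _; rewrite s_0.
  rewrite (_ : [set _ | _] = set0); first exact: measurable0.
  by apply/seteqP; split=> w //=; rewrite s_0.
rewrite (_ : [set w | _] = [set w | (fun b w => S (step b (s n w))) (w n) w]).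
  rewrite (set_coord_split n (fun b w => S (step b (s n w)))).
  by apply: measurableU; apply: measurableI;
    [exact: measurable_coord|exact: (IH (fun t => S (step _ t)))
    |exact: measurable_coord|exact: (IH (fun t => S (step _ t)))].
by apply/seteqP; split=> w /=; rewrite s_S.
Qed.

Lemma measurable_height_ge (n j : nat) :
  measurable [set w | (j <= height n w)%N].
Proof.
exact: (@measurable_prefix _ 0%N (fun b k => if b then k.-1 else k.+1) height n
  [set k | (j <= k)%N]).
Qed.

Lemma measurable_dist_lt {R : realType} (x y : R) (n : nat) (t : R) :
  measurable [set w | `|trajectory x n w - trajectory y n w| < t].
Proof.
pose step b (z : R * R) :=
  (if b then (fmap3 z.1, fmap3 z.2) else (gmap3 z.1, gmap3 z.2)).
apply: (@measurable_prefix _ (x, y) step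
  (fun n w => (trajectory x n w, trajectory y n w)) n
  [set z | `|z.1 - z.2| < t]) => // m w.
by rewrite /step /=; case: (w m).
Qed.

(** * The law of the height under the product measure *)

Definition cyl (J : seq nat) (v : nat -> bool) : set words :=
  [set w | forall n, n \in J -> w n = v n].

Lemma measurable_cyl J v : measurable (cyl J v).
Proof.
elim: J => [|n J IH].
  rewrite (_ : cyl _ _ = setT); first exact: measurableT.
  by apply/seteqP; split=> w.
rewrite (_ : cyl _ _ = [set w : words | w n = v n] `&` cyl J v).
  by apply: measurableI => //; exact: measurable_coord.
apply/seteqP; split=> [w h|w [h1 h2] m].
  by split=> [|m mJ]; apply: h; rewrite in_cons ?eqxx ?mJ ?orbT.
by rewrite in_cons => /orP[/eqP ->//|]; exact: h2.
Qed.

Section height_law.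
Context {R : realType} (p : R) (P : probability words R).
Hypothesis hP : is_product_measure p P.

Local Notation weight b := (if b then p else 1 - p).

Lemma prob_cyl J v : uniq J -> P (cyl J v) = (\prod_(n <- J) weight (v n))%:E.
Proof.
case: hP => ht hf hJ uJ.
rewrite (hJ J (fun n => [set v n]) uJ) -prodEFin.
by apply: eq_bigr => n _ /=; case: (v n); rewrite ?ht ?hf.
Qed.

(* The induction needs independence of the height at time [n] from all the
   coordinates still to come, whence the cylinder on coordinates [>= n]. *)
Lemma prob_height_ge_cyl n j J v : uniq J -> all (leq n) J ->
  P ([set w | (j <= height n w)%N] `&` cyl J v) =
  (tail_height p n j * \prod_(i <- J) weight (v i))%:E.
Proof.
elim: n j J v => [|n IH] j J v uJ nJ.
  case: j => [|j] /=.
    by rewrite mul1r -prob_cyl //; congr (P _); apply/seteqP; split=> w // [].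
  by rewrite mul0r (_ : _ `&` _ = set0) ?measure0 //;
    apply/seteqP; split=> w // [].
case: j => [|j].
  rewrite [tail_height _ _ _]/= mul1r -prob_cyl //; congr (P _).
  by apply/seteqP; split=> w // [].
(* The letter at [n] joins the cylinder with prescribed value [b], so that the induction hypothesis
   at time [n] applies to each value. *)
pose J' := n :: J.
pose v' b m := if m == n then b else v m.
have nJ' : n \notin J.
  by apply/negP => nIn; move/allP: nJ => /(_ _ nIn); rewrite ltnn.
have uJ' : uniq J' by rewrite /= nJ'.
have aJ' : all (leq n) J'.
  by rewrite /= leqnn; apply/allP => m mJ; move/allP: nJ => /(_ _ mJ) /ltnW.
have prodE b : \prod_(i <- J') weight (v' b i) =
    weight b * \prod_(i <- J) weight (v i).
  rewrite /J' big_cons /v' eqxx; congr (_ * _).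
  apply: eq_big_seq => m mJ; case: eqP => // mn.
  by move: nJ'; rewrite -mn mJ.
have cylE b : cyl J' (v' b) = [set w : words | w n = b] `&` cyl J v.
  apply/seteqP; split=> [w h|w [h1 h2] m].
    split=> [|m mJ] /=.
      by rewrite h ?/v' ?eqxx // in_cons eqxx.
    rewrite h ?/v' ?in_cons ?mJ ?orbT //; case: eqP => // mn.
    by move: nJ'; rewrite -mn mJ.
  rewrite in_cons /v'; case: eqP => [->//|_] /=; exact: h2.
(* Height at least [j.+1] at time [n.+1] means at least [j.+2] before an f and at least [j] before a
   g; as the level [j.+1] is positive, reflection at 0 does not interfere. *)
set A := [set w | (j.+2 <= height n w)%N] `&` cyl J' (v' true).
set B := [set w | (j <= height n w)%N] `&` cyl J' (v' false).
transitivity (P A + P B)%E; last first.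
  by rewrite !IH // !prodE -EFinD /=; congr (_%:E); ring.
transitivity (P (A `|` B)); last first.
  apply: measureU.
  - by apply: measurableI; [exact: measurable_height_ge|exact: measurable_cyl].
  - by apply: measurableI; [exact: measurable_height_ge|exact: measurable_cyl].
  - by rewrite /A /B !cylE; apply/seteqP; split=> w // [[_ [/= -> _]] [_ [/=]]].
congr (P _); rewrite /A /B.
rewrite !cylE; apply/seteqP; split=> w /=.
  case=> + hc; case E1: (w n) => h; [left|right]; split=> //.
  by case: (height n w) h.
by case=> -[h [-> hc]]; split=> //; case: (height n w) h.
Qed.

Lemma prob_height_ge n j :
  P [set w | (j <= height n w)%N] = (tail_height p n j)%:E.
Proof.
have := @prob_height_ge_cyl n j [::] (fun=> true) isT isT.
rewrite big_nil mulr1 => <-; congr (P _).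
by apply/seteqP; split=> w // [].
Qed.

End height_law.

(** * Comparison of the height with its geometric stationary law *)

Section tail_height_bounds.
Context {R : realType} (p : R).
Hypothesis hp : 1 / 2 < p <= 1.

Local Notation r := ((1 - p) / p).

Let p_gt0 : 0 < p. Proof. by move: hp => ?; lra. Qed.
Let p_le1 : p <= 1. Proof. by case/andP: hp. Qed.

Lemma mulr_ratio : p * r = 1 - p.
Proof. by rewrite mulrC divfK // gt_eqF. Qed.

Lemma ratio_ge0_lt1 : 0 <= r < 1.
Proof.
apply/andP; split; first by rewrite divr_ge0 ?(ltW p_gt0) // subr_ge0.
by rewrite ltr_pdivrMr // mul1r; move: hp => ?; lra.
Qed.

Lemma tail_height_ge0 n j : 0 <= tail_height p n j.
Proof.
elim: n j => [|n IH] [|j] //=.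
by rewrite addr_ge0 // mulr_ge0 ?(ltW p_gt0) // subr_ge0.
Qed.

Lemma tail_height0 n : tail_height p n 0 = 1.
Proof. by case: n. Qed.

Lemma tail_height_eq0 n j : (n < j)%N -> tail_height p n j = 0.
Proof.
elim: n j => [|n IH] [|j] //= nj.
by rewrite !IH ?mulr0 ?addr0 // ltnS ltnW // ltnW.
Qed.

(** The stationary tail [r ^+ j] solves the same recursion, because p r^2 + (1 - p) = r, and
    dominates the tail at time 0; the recursion has nonnegative coefficients, so the order
    persists. *)
Lemma tail_height_le n j : tail_height p n j <= r ^+ j.
Proof.
have /andP[r0 _] := ratio_ge0_lt1.
elim: n j => [|n IH] [|j]; rewrite ?expr0 //= ?exprn_ge0 //.
have := IH j; have := IH j.+2; rewrite !exprS => h1 h2.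
rewrite (_ : r * r ^+ j = p * (r * (r * r ^+ j)) + (1 - p) * r ^+ j).
  by rewrite lerD // ler_wpM2l // ?(ltW p_gt0) // subr_ge0.
by move: mulr_ratio; set r := _ / _ => pr; rewrite -pr; ring: pr.
Qed.

(** Bounds the mean height uniformly in time, by a geometric series. *)
Lemma sum_tail_height_le n m : \sum_(j < m) tail_height p n j.+1 <= (1 - r)^-1.
Proof.
have /andP[r0 r1] := ratio_ge0_lt1.
have r2 : 0 < 1 - r by lra.
have rm : 0 <= r ^+ m.+1 by rewrite exprn_ge0.
suff h : (1 - r) * \sum_(j < m) tail_height p n j.+1 <= 1 - r ^+ m.+1.
  by rewrite -[leRHS]mul1r ler_pdivlMr // mulrC; lra.
elim: m {rm} => [|m IH]; first by rewrite big_ord0 expr1; lra.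
rewrite big_ord_recr /= mulrDr [r ^+ m.+2]exprS.
have := tail_height_le n m.+1; nra.
Qed.

Lemma sum_tail_heightS n m :
  \sum_(j < m) tail_height p n.+1 j.+1 =
  \sum_(j < m) tail_height p n j.+1
  + p * (tail_height p n m.+1 - tail_height p n 1)
  - (1 - p) * (tail_height p n m - 1).
Proof.
elim: m => [|m IH]; first by rewrite !big_ord0 tail_height0; ring.
by rewrite !big_ord_recr /= IH; ring.
Qed.

(* The expected height at time [n], obtained by summing its increments
   [(1 - p) - p P(height > 0)]. *)
Lemma mean_height n m : (n <= m)%N ->
  \sum_(j < m) tail_height p n j.+1 =
  n%:R * (1 - p) - p * \sum_(0 <= i < n) tail_height p i 1.
Proof.
elim: n => [|n IH] nm.
  by rewrite big_geq // mul0r mulr0 subr0 big1.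
rewrite sum_tail_heightS IH ?(ltnW nm) // big_nat_recr //=.
rewrite (tail_height_eq0 nm) (tail_height_eq0 (ltnW nm : n < m.+1)%N).
rewrite -[n.+1%:R]natr1; ring.
Qed.

(** Occupation times fall short of their stationary value by at most a constant, which gives the
    ergodic lower bound without a convergence theorem. Level 1 follows from the bounded mean height;
    higher levels follow by induction from the recursion summed over time. *)
Lemma sum_time_tail_height_ge j : exists C : R, forall n,
  n%:R * r ^+ j - C <= \sum_(0 <= i < n) tail_height p i j.
Proof.
move: mulr_ratio sum_tail_height_le tail_height_le.
set r := _ / _ => pr sum_le tail_le; case: j => [|j].
  exists 0 => n; rewrite subr0 expr0 mulr1.
  under eq_bigr do rewrite tail_height0.
  by rewrite sumr_const_nat subn0.
elim: j => [|j [C hC]].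
  exists ((1 - r)^-1 / p) => n.
  have h1 := sum_le n n; rewrite mean_height // in h1.
  rewrite -(ler_pM2l p_gt0) mulrBr expr1 mulrCA pr (mulrC p (_ / p)) divfK ?gt_eqF //; lra.
exists (C / p) => n.
(* Summing the recursion shifts time by one; the boundary term at time 0 vanishes since the level is
   positive. *)
have hS : p * \sum_(0 <= i < n) tail_height p i j.+2
        + (1 - p) * \sum_(0 <= i < n) tail_height p i j
        = \sum_(0 <= i < n) tail_height p i j.+1 + tail_height p n j.+1.
  elim: n => [|n IH]; first by rewrite !big_geq //=; ring.
  by rewrite !big_nat_recr //= !mulrDr addrACA IH; ring.
(* Level [j] enters with a minus sign when [hS] is solved for level [j.+2], so an upper bound is
   needed here. *)
have hj : \sum_(0 <= i < n) tail_height p i j <= n%:R * r ^+ j.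
  rewrite mulr_natl -[X in _ *+ X]subn0 -sumr_const_nat.
  by apply: ler_sum => i _; exact: tail_le.
rewrite -(ler_pM2l p_gt0) mulrBr (mulrC p (_ / p)) divfK ?gt_eqF //.
have a0 := tail_height_ge0 n j.+1.
have := hC n; rewrite !exprS => hCn.
have hE : p * (n%:R * (r * (r * r ^+ j))) =
    n%:R * (r * r ^+ j) - (1 - p) * (n%:R * r ^+ j).
  by ring: pr.
have q0 : 0 <= 1 - p by rewrite subr_ge0.
have := ler_wpM2l q0 hj.
by rewrite hE; lra.
Qed.

End tail_height_bounds.

(** * Lower and upper limits of sequences in [0, 1] *)

Section unit_valued_sequences.
Context {R : realType}.
Implicit Types u v : nat -> R.

Lemma unit_has_ubound u : (forall n, 0 <= u n <= 1) -> has_ubound (range u).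
Proof. by move=> u01; exists 1 => _ [n _ <-]; case/andP: (u01 n). Qed.

Lemma unit_has_lbound u : (forall n, 0 <= u n <= 1) -> has_lbound (range u).
Proof. by move=> u01; exists 0 => _ [n _ <-]; case/andP: (u01 n). Qed.

(** [limn_inf] is a real-valued [lim], hence meaningful only once [infs u] is known to converge. *)
Lemma unit_is_cvg_infs u : (forall n, 0 <= u n <= 1) -> cvgn (infs u).
Proof.
move=> u01; apply/cvg_ex; eexists; apply: cvg_infs_sup.
  exact: unit_has_ubound.
exact: unit_has_lbound.
Qed.

Lemma unit_is_cvg_sups u : (forall n, 0 <= u n <= 1) -> cvgn (sups u).
Proof.
move=> u01; apply/cvg_ex; eexists; apply: cvg_sups_inf.
  exact: unit_has_ubound.
exact: unit_has_lbound.
Qed.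

Lemma infs_le u n k : (forall n, 0 <= u n <= 1) -> (n <= k)%N -> infs u n <= u k.
Proof.
move=> u01 nk; apply: ge_inf; last by exists k.
exact/has_lbound_sdrop/unit_has_lbound.
Qed.

Lemma sups_ge u n k : (forall n, 0 <= u n <= 1) -> (n <= k)%N -> u k <= sups u n.
Proof.
move=> u01 nk; apply: ub_le_sup; last by exists k.
exact/has_ubound_sdrop/unit_has_ubound.
Qed.

Lemma infs_glb u n (c : R) : (forall k, (n <= k)%N -> c <= u k) -> c <= infs u n.
Proof.
move=> cu; apply: lb_le_inf; first by exists (u n); exists n => /=.
by move=> _ [k nk <-]; exact: cu.
Qed.

Lemma sups_lub u n (c : R) : (forall k, (n <= k)%N -> u k <= c) -> sups u n <= c.
Proof.
move=> cu; apply: ge_sup; first by exists (u n); exists n => /=.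
by move=> _ [k nk <-]; exact: cu.
Qed.

Lemma unit_le_limn_inf u v :
  (forall n, 0 <= u n <= 1) -> (forall n, 0 <= v n <= 1) ->
  (forall n, u n <= v n) -> limn_inf u <= limn_inf v.
Proof.
move=> u01 v01 uv; apply: ler_lim; [exact: unit_is_cvg_infs..|].
apply: nearW => n; apply: infs_glb => k nk.
exact: le_trans (infs_le u01 nk) (uv k).
Qed.

Lemma unit_le_limn_sup u v :
  (forall n, 0 <= u n <= 1) -> (forall n, 0 <= v n <= 1) ->
  (forall n, u n <= v n) -> limn_sup u <= limn_sup v.
Proof.
move=> u01 v01 uv; apply: ler_lim; [exact: unit_is_cvg_sups..|].
apply: nearW => n; apply: sups_lub => k nk.
exact: le_trans (uv k) (sups_ge v01 nk).
Qed.

Lemma unit_limn_inf_sup u : (forall n, 0 <= u n <= 1) -> limn_inf u <= limn_sup u.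
Proof.
move=> u01; apply: ler_lim; [exact: unit_is_cvg_infs|exact: unit_is_cvg_sups|].
by apply: nearW => n; exact: le_trans (infs_le u01 (leqnn n)) (sups_ge u01 (leqnn n)).
Qed.

Lemma unit_limn_sup_le1 u : (forall n, 0 <= u n <= 1) -> limn_sup u <= 1.
Proof.
move=> u01; apply: limr_le; first exact: unit_is_cvg_sups.
by apply: nearW => n; apply: sups_lub => k _; case/andP: (u01 k).
Qed.

Lemma unit_limn_inf_ge u (c : R) : (forall n, 0 <= u n <= 1) ->
  (forall e, 0 < e -> \forall n \near \oo, c - e <= u n) -> c <= limn_inf u.
Proof.
move=> u01 cu; apply/ler_addgt0Pr => e e0; rewrite -lerBlDr.
apply: limr_ge; first exact: unit_is_cvg_infs.
have [N _ hN] := cu _ e0.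
exists N => // n /= Nn; apply: infs_glb => k nk.
by apply: hN => /=; exact: leq_trans nk.
Qed.

End unit_valued_sequences.

(** * Bounds and measurability for the distribution functions *)

Section separation_frequencies.
Context {R : realType} (p : R) (P : probability words R) (x y : R).
Hypotheses (hP : is_product_measure p P) (hp : 1 / 2 < p <= 1).
Hypotheses (hx : 0 <= x <= 1) (hy : 0 <= y <= 1).

Local Notation near_event i t :=
  [set w | `|trajectory x i w - trajectory y i w| < t].

Lemma prob_near_le1 i t : 0 <= fine (P (near_event i t)) <= 1.
Proof.
rewrite fine_ge0 //= -lee_fin fineK ?fin_num_measure //.
  by apply: probability_le1; exact: measurable_dist_lt.
exact: measurable_dist_lt.
Qed.

Lemma prob_near_nondecreasing i (s t : R) : s <= t ->
  fine (P (near_event i s)) <= fine (P (near_event i t)).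
Proof.
move=> st; apply: fine_le.
- by apply: fin_num_measure; exact: measurable_dist_lt.
- by apply: fin_num_measure; exact: measurable_dist_lt.
apply: le_measure; rewrite ?inE; try exact: measurable_dist_lt.
by move=> w /= h; exact: lt_le_trans st.
Qed.

Lemma prob_near_ge i j (t : R) : 3^-1 ^+ j < t ->
  tail_height p i j <= fine (P (near_event i t)).
Proof.
move=> jt; rewrite -lee_fin fineK; last first.
  by apply: fin_num_measure; exact: measurable_dist_lt.
rewrite -(prob_height_ge hP).
apply: le_measure; rewrite ?inE.
- exact: measurable_height_ge.
- exact: measurable_dist_lt.
move=> w /= jh; apply: le_lt_trans jt.
apply: (le_trans (trajectory_dist_le i w hx hy)).
by apply: ler_wiXn2l => //; rewrite ?invr_ge0 // invf_le1 //; lra.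
Qed.

Lemma Fn_unit t n : 0 <= Fn P x y n t <= 1.
Proof.
have [->|n0] := eqVneq n 0%N.
  by rewrite /Fn big_geq // mulr0 lexx ler01.
have n1 : 0 < n%:R :> R by rewrite ltr0n lt0n.
rewrite /Fn; apply/andP; split.
  rewrite mulr_ge0 ?invr_ge0 ?ler0n // sumr_ge0 // => i _.
  by case/andP: (prob_near_le1 i t).
rewrite ler_pdivrMl // mulr1 -[leRHS]mulr1 mulr_natl -[X in _ *+ X]subn0.
rewrite -sumr_const_nat; apply: ler_sum => i _.
by case/andP: (prob_near_le1 i t).
Qed.

Lemma Fn_nondecreasing n (s t : R) : s <= t -> Fn P x y n s <= Fn P x y n t.
Proof.
move=> st; rewrite /Fn ler_wpM2l ?invr_ge0 ?ler0n //.
by apply: ler_sum => i _; exact: prob_near_nondecreasing.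
Qed.

(** Upper limits preserve order, so [Fsup] is monotone in [t], hence measurable. *)
Lemma measurable_Fsup (D : set R) :
  measurable D -> measurable_fun D (Fsup P x y).
Proof.
move=> mD; apply: nondecreasing_measurable => // s t st.
apply: unit_le_limn_sup; [exact: Fn_unit..|] => n.
exact: Fn_nondecreasing.
Qed.

Lemma measurable_Finf (D : set R) :
  measurable D -> measurable_fun D (Finf P x y).
Proof.
move=> mD; apply: nondecreasing_measurable => // s t st.
apply: unit_le_limn_inf; [exact: Fn_unit..|] => n.
exact: Fn_nondecreasing.
Qed.

Lemma Finf_le_Fsup t : Finf P x y t <= Fsup P x y t.
Proof. by apply: unit_limn_inf_sup; exact: Fn_unit. Qed.

Lemma Fsup_le1 t : Fsup P x y t <= 1.
Proof. by apply: unit_limn_sup_le1; exact: Fn_unit. Qed.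

Lemma Finf_ge0 t : 0 <= Finf P x y t.
Proof.
apply: unit_limn_inf_ge; first exact: Fn_unit.
move=> e e0; apply: nearW => n.
by have := Fn_unit t n; lra.
Qed.

(** Height at least [j] forces distance below [t], and the constant deficit in occupation time
    vanishes after division by [n]. *)
Lemma Finf_ge j (t : R) : 3^-1 ^+ j < t -> ((1 - p) / p) ^+ j <= Finf P x y t.
Proof.
move=> jt; apply: unit_limn_inf_ge; first exact: Fn_unit.
move=> e e0; have [C hC] := sum_time_tail_height_ge hp j.
near=> n.
have n0 : 0 < n%:R :> R by near: n; exact: nbhs_infty_gtr.
have nC : C / e <= n%:R by near: n; exact: nbhs_infty_ger.
rewrite /Fn ler_pdivlMl //.
apply: (@le_trans _ _ (n%:R * ((1 - p) / p) ^+ j - C)).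
  by move: nC; rewrite ler_pdivrMr // mulrBr; lra.
apply: le_trans (hC n) _.
by apply: ler_sum => i _; exact: prob_near_ge.
Unshelve. all: by end_near. Qed.

End separation_frequencies.

(** * Step functions with jumps at powers of 1/3 and the truncated geometric law *)

Lemma integral_step_sum {R : realType} (c : nat -> R) (N : nat) :
  (forall k, 0 <= c k) ->
  (\int[lebesgue_measure]_(t in `[0%R, 1%R])
     (\sum_(k < N) c k * \1_(`]-oo, (3^-1 ^+ k)]%classic : set R) t)%:E
   = (\sum_(k < N) c k * 3^-1 ^+ k)%:E)%E.
Proof.
move=> c0.
under eq_integral do rewrite -sumEFin.
rewrite ge0_integral_sum //.
- rewrite -sumEFin; apply: eq_bigr => k _.
  under eq_integral do rewrite EFinM.
  rewrite ge0_integralZl_EFin //; first last.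
  + by apply/measurable_EFinP; exact: measurable_indic.
  rewrite integral_indic // EFinM; congr (_ * _)%E.
  have q0 : 0 <= (3^-1 : R) ^+ k by rewrite exprn_ge0 // invr_ge0.
  have q1 : (3^-1 : R) ^+ k <= 1.
    by rewrite exprn_ile1 // ?invr_ge0 // invf_le1 //; lra.
  rewrite (_ : _ `&` _ = `[0, (3^-1 ^+ k)]%classic); last first.
    by apply/seteqP; split=> t /=; rewrite !in_itv /=; lra.
  transitivity (lebesgue_measure (`[0, (3^-1 ^+ k)]%classic : set R)) => //.
  rewrite lebesgue_measure_itv /= lte_fin -EFinB subr0.
  by case: ltP => // h; congr (_%:E); apply/eqP; rewrite eq_le q0 h.
- by move=> k; apply/measurable_EFinP; apply: measurable_funM.
- by move=> k t _; rewrite lee_fin mulr_ge0.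
Qed.

(* The law of [3^-k] for [k] geometric of ratio [r], with all the mass
   [k > N] moved to [k = N]. *)
Definition trunc_geom {R : realType} (r : R) (N k : nat) : R :=
  if (k < N)%N then (1 - r) * r ^+ k else r ^+ k.

Lemma trunc_geom_sum {R : realType} (r : R) (N : nat) (F : nat -> R) :
  \sum_(k < N.+1) trunc_geom r N k * F k =
  \sum_(k < N) (1 - r) * r ^+ k * F k + r ^+ N * F N.
Proof.
rewrite big_ord_recr /= {2}/trunc_geom ltnn; congr (_ + _).
by apply: eq_bigr => k _; rewrite /trunc_geom ltn_ord.
Qed.

(** The right side is the truncated mass of those k with t <= 3^-k: it is 1 if t <= 3^-N, and
    otherwise 1 - r^j for the least j with 3^-j < t. *)
Lemma le_trunc_geom_tail {R : realType} (r t d : R) (N : nat) :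
  0 <= t <= 1 -> d <= 1 -> (forall j, 3^-1 ^+ j < t -> d <= 1 - r ^+ j) ->
  d <= \sum_(k < N.+1)
         trunc_geom r N k * \1_(`]-oo, (3^-1 ^+ k)]%classic : set R) t.
Proof.
move=> ht d1 hd.
rewrite (trunc_geom_sum r N (fun k => \1_(`]-oo, (3^-1 ^+ k)]%classic : set R) t)).
under eq_bigr do rewrite indicE mem_setE in_itv /=.
rewrite indicE mem_setE in_itv /=.
set S := fun N => \sum_(k < N) (1 - r) * r ^+ k * (t <= 3^-1 ^+ k)%R%:R
   + r ^+ N * (t <= 3^-1 ^+ N)%R%:R.
(* The second conjunct is carried along because [S] changes only when 3^-(N+1) < t <= 3^-N, dropping
   from exactly 1 to 1 - r^(N+1). *)
suff [] : d <= S N /\ (t <= 3^-1 ^+ N -> S N = 1) by [].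
elim: N => [|N [IH1 IH2]].
  rewrite /S big_ord0 !expr0 add0r mul1r.
  by case/andP: ht => _ ->; split.
have SE : S N.+1 = S N +
    r ^+ N.+1 * ((t <= 3^-1 ^+ N.+1)%R%:R - (t <= 3^-1 ^+ N)%R%:R).
  by rewrite /S big_ord_recr /= [r ^+ N.+1]exprS; ring.
have q0 : 0 <= (3^-1 : R) ^+ N by rewrite exprn_ge0 // invr_ge0.
have qq : (3^-1 : R) ^+ N.+1 <= 3^-1 ^+ N by rewrite exprS; lra.
rewrite SE; have [h1|h1] := leP t (3^-1 ^+ N.+1).
  have h2 := le_trans h1 qq.
  by rewrite h2 subrr mulr0 addr0; split => // _; exact: IH2.
split=> //; have [h2|h2] := leP t (3^-1 ^+ N); last by rewrite subrr mulr0 addr0.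
by rewrite IH2 // sub0r mulrN1; exact: hd.
Qed.

(** The atoms below [N] form a partial sum of the stationary mean; the displaced mass contributes at
    most 3^-N. *)
Lemma trunc_geom_mean_le {R : realType} (p : R) (N : nat) : 1 / 2 < p <= 1 ->
  \sum_(k < N.+1) trunc_geom ((1 - p) / p) N k * 3^-1 ^+ k <=
  (6 * p - 3) / (4 * p - 1) + 3^-1 ^+ N.
Proof.
move=> hp; rewrite (trunc_geom_sum _ N (fun k => 3^-1 ^+ k)).
have /andP[r0 r1] := ratio_ge0_lt1 hp.
have p0 : 0 < p by lra.
have p1 : 0 < 4 * p - 1 by lra.
set r := (1 - p) / p in r0 r1 *.
have q0 : 0 <= (3^-1 : R) ^+ N by rewrite exprn_ge0 // invr_ge0.
rewrite lerD //; last by rewrite ler_piMl // exprn_ile1 // ltW.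
have -> : (6 * p - 3) / (4 * p - 1) = (1 - r) / (1 - r / 3).
  rewrite /r; field; rewrite ?gt_eqF //; lra.
have s0 : 0 < 1 - r / 3 by lra.
rewrite ler_pdivlMr //.
have -> : (\sum_(k < N) (1 - r) * r ^+ k * 3^-1 ^+ k) * (1 - r / 3) =
   (1 - r) * (1 - (r / 3) ^+ N).
  elim: N {q0} => [|N IH]; first by rewrite big_ord0 expr0; ring.
  by rewrite big_ord_recr /= mulrDl IH exprS exprMn; ring.
rewrite ler_piMr //; first by lra.
have : 0 <= (r / 3) ^+ N by rewrite exprn_ge0 // divr_ge0.
by lra.
Qed.

(** * Integration of the pointwise bound *)

Theorem proposition5p2 (R : realType) (p : R) (P : probability words R)
    (hP : is_product_measure p P) (hp : 1 / 2 < p <= 1)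
    (x y : R) (hx : 0 <= x <= 1) (hy : 0 <= y <= 1) :
  (\int[lebesgue_measure]_(t in `[0%R, 1%R]) (Fsup P x y t - Finf P x y t)%:E
    <= ((6 * p - 3) / (4 * p - 1))%:E)%E.
Proof.
have /andP[r0 r1] := ratio_ge0_lt1 hp.
set r := (1 - p) / p in r0 r1 *.
have c0 N k : 0 <= trunc_geom r N k.
  by rewrite /trunc_geom; case: ifP; rewrite ?mulr_ge0 ?exprn_ge0 //; lra.
(* The slack [e] absorbs the truncation error 3^-N, so only finite sums are integrated. *)
apply/lee_addgt0Pr => e e0.
have [N Ne] : exists N, 3^-1 ^+ N <= e.
  have /cvgrPdist_le/(_ _ e0) : (3^-1 : R) ^+ n @[n --> \oo] --> 0.
    by apply: cvg_expr; rewrite ger0_norm ?invr_ge0 // invf_lt1 //; lra.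
  move=> [N _ hN]; exists N; apply: le_trans (hN N (leqnn N)).
  by rewrite sub0r normrN ler_norm.
apply: (@le_trans _ _ (\int[lebesgue_measure]_(t in `[0%R, 1%R])
    (\sum_(k < N.+1) trunc_geom r N k
        * \1_(`]-oo, (3^-1 ^+ k)]%classic : set R) t)%:E)%E).
  apply: ge0_le_integral => //.
  - by move=> t _; rewrite lee_fin subr_ge0; exact: Finf_le_Fsup.
  - apply/measurable_EFinP; apply: measurable_funB.
      exact: measurable_Fsup.
    exact: measurable_Finf.
  - apply/measurable_EFinP; apply: measurable_sum => k.
    by apply: measurable_funM => //; exact: measurable_indic.
  move=> t; rewrite /= in_itv /= => t01; rewrite lee_fin.
  (* Here d is [Fsup] minus [Finf]: at most 1 always, and at most 1 - r^j once 3^-j < t. *)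
  apply: le_trunc_geom_tail => //.
    have := Fsup_le1 P x y t; have := Finf_ge0 P x y t; lra.
  move=> j jt; rewrite lerB //; first exact: Fsup_le1.
  exact: Finf_ge hP hp hx hy _ _ jt.
rewrite integral_step_sum // -EFinD lee_fin.
apply: le_trans (trunc_geom_mean_le N hp) _.
by rewrite lerD2l.
Qed.
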